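(* Let a sensing matrix $A\in\mathbb{R}^{m\times n}$, a representation structure $\mathcal{S}_\infty=(B,n_1,\dots,n_K,\|\cdot\|_\infty,\dots,\|\cdot\|_\infty)$ with $N=n_1+\cdots+n_K$, an uncertainty set $\mathcal{U}\subset\mathbb{R}^m$ (compact, convex, symmetric w.r.t. the origin), a matrix $D\in\mathbb{R}^{m\times m}$ and $\varepsilon\in(0,1/2)$ be given, and let $\xi=D\eta$ with $\eta\sim\mathcal{N}(0,I_m)$. Suppose that for every $r>0$ the set $\{u+De:\ u\in\mathcal{U},\ \|e\|_2\le r\}$ contains a neighborhood of the origin. Given a positive integer $S$, assume that there exists a recovering routine $\widehat{x}$ (a mapping $\mathbb{R}^m\to\mathbb{R}^n$) such that, for some $\alpha>0$ and for all $x\in\mathbb{R}^n$, $u\in\mathcal{U}$, $$\mathrm{Prob}_\xi\Big(\|B[x-\widehat{x}(Ax+u+\xi)]\|_\infty\le\alpha+S^{-1}L_1(Bx-[Bx]^S)\Big)\ge1-\varepsilon.$$ Then there exist $H=[h^1,\dots,h^N]\in\mathbb{R}^{m\times N}$ and $V=[V^{k\ell}\in\mathbb{R}^{n_k\times n_\ell}]_{k,\ell=1}^K$ satisfying: (a) $B=VB+H^TA$; (b) $\|V^{k\ell}\|_{\infty,\infty}\le 2S^{-1}$ for all $k,\ell\le K$; (c) with $$\rho:=\max_{1\le i\le N}\Big[\max_{u\in\mathcal{U}}u^Th^i+\mathrm{ErfInv}\Big(\frac{\varepsilon}{2N}\Big)\|D^Th^i\|_2\Big]$$ one has $\rho\le2\alpha$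 when $D=0$, and $\rho\le2\alpha\,\frac{\mathrm{ErfInv}(\varepsilon/(2N))}{\mathrm{ErfInv}(\varepsilon)}$ when $D\ne0$; and for $\xi=D\eta$, $\eta\sim\mathcal{N}(0,I_m)$, one has $$\mathrm{Prob}_\xi\Big(\Xi^+:=\Big\{\xi:\ \max_{u\in\mathcal{U}}u^Th^i+|\xi^Th^i|\le\rho,\ 1\le i\le N\Big\}\Big)\ge1-\varepsilon.$$
   Context: The representation structure $\mathcal{S}_\infty$ consists of positive integers $n_1,\dots,n_K$ with $N=n_1+\cdots+n_K$, a matrix $B=[B[1];\dots;B[K]]\in\mathbb{R}^{N\times n}$ (vertical concatenation, $B[k]\in\mathbb{R}^{n_k\times n}$), and the uniform norm $\|\cdot\|_\infty$ on each block space $\mathbb{R}^{n_k}$. Vectors $w\in\mathbb{R}^N$ are written in blocks $w=[w[1];\dots;w[K]]$, $w[k]\in\mathbb{R}^{n_k}$. $L_1(w)=\sum_{k=1}^K\|w[k]\|_\infty$; $[w]^S$ is obtained from $w$ by zeroing out all but the $S$ blocks largest in $\|\cdot\|_\infty$ norm (ties resolved arbitrarily). $\|M\|_{\infty,\infty}$ denotes the norm of the linear operator $u\mapsto Mu$ induced by $\|\cdot\|_\infty$ on both argument and image spaces, i.e. the maximum of the $\ell_1$-norms of the rows of $M$. $\mathrm{ErfInv}(\delta)$, $\delta\in(0,1)$, is the number $t$ with $\frac{1}{\sqrt{2\pi}}\int_t^\infty e^{-\tau^2/2}\,d\tau=\delta$ (the upper $\delta$-quantile of the standard normal law). *)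

(* Defs.v *)
From HB Require Import structures.
From mathcomp Require Import all_boot all_order all_algebra.
From mathcomp Require Import all_classical all_reals all_analysis.

Set Implicit Arguments.
Unset Strict Implicit.
Unset Printing Implicit Defensive.

Import Order.TTheory GRing.Theory Num.Theory.
Import numFieldNormedType.Exports.

Local Open Scope classical_set_scope.
Local Open Scope ring_scope.

(* Throughout, `|w| for w : 'cV[R]_p is the norm of matrix_normedtype, that is,
   the uniform norm, and a vector of R^N, N = \sum_k n_ k, is cut into blocks
   by submxcol. *)

Definition dotv (R : realType) (p : nat) (u v : 'cV[R]_p) : R :=
  (u^T *m v) 0 0.

Definition norm2 (R : realType) (p : nat) (v : 'cV[R]_p) : R :=
  Num.sqrt (\sum_i v i 0 ^+ 2).

Definition opnorm_inf (R : realType) (p q : nat) (M : 'M[R]_(p, q)) : R :=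
  sup [set `|M *m u| | u in [set u : 'cV[R]_q | `|u| <= 1]].

Definition L1 (R : realType) (K : nat) (n_ : 'I_K -> nat)
    (w : 'cV[R]_(\sum_k n_ k)) : R :=
  \sum_k `|submxcol w k|.

(* Ties are broken in favour of the smaller index: sort is stable. *)
Definition largest_blocks (R : realType) (K : nat) (n_ : 'I_K -> nat) (S : nat)
    (w : 'cV[R]_(\sum_k n_ k)) : seq 'I_K :=
  take S (sort (fun k l => `|submxcol w l| <= `|submxcol w k|) (enum 'I_K)).

Definition trunc_blocks (R : realType) (K : nat) (n_ : 'I_K -> nat) (S : nat)
    (w : 'cV[R]_(\sum_k n_ k)) : 'cV[R]_(\sum_k n_ k) :=
  \mxcol_k (if k \in largest_blocks S w then submxcol w k else 0).

(* For 0 < delta < 1 the solution t exists and is unique. *)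
Definition ErfInv (R : realType) (delta : R) : R :=
  xget 0 [set t : R |
    ((Num.sqrt (2 * pi))^-1%:E *
      \int[lebesgue_measure]_(tau in `[t, +oo[) (expR (- tau ^+ 2 / 2))%:E
      = delta%:E)%E].

(* The standard Gaussian law N(0, I_m) on R^m, as the m-fold product of
   normal_prob 0 1 carried to m.-tuple R by consing coordinates. *)
Section std_gaussian.
Context (R : realType).
Local Notation T := (measurableTypeR R).

Definition cons_pair (m : nat) (p : T * m.-tuple T) : m.+1.-tuple T :=
  [tuple of p.1 :: p.2].

Lemma measurable_cons_pair (m : nat) :
  measurable_fun [set: T * m.-tuple T] (@cons_pair m).
Proof. exact: measurable_cons. Qed.

HB.instance Definition _ (m : nat) :=
  isMeasurableFun.Build _ _ _ _ (@cons_pair m) (@measurable_cons_pair m).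

Fixpoint std_gaussian (m : nat) : probability (m.-tuple T) R :=
  match m with
  | 0%N => dirac [tuple]
  | m'.+1 => distribution (normal_prob 0 1 \x std_gaussian m')%E (@cons_pair m')
  end.

End std_gaussian.

(* Box formula: under std_gaussian the coordinates are i.i.d. N(0, 1). *)
Lemma std_gaussian_box (R : realType) (m : nat) (F : 'I_m -> set R) :
  (forall i, measurable (F i)) ->
  (std_gaussian R m [set t | forall i, F i (tnth t i)] =
   \prod_(i < m) normal_prob 0 1 (F i))%E.
Proof.
elim: m F => [|m IH] F mF.
  by rewrite big_ord0 /= diracE [_ \in _]mem_set// => -[].
rewrite big_ord_recl /= /distribution /pushforward.
rewrite -IH => [|i]; last exact: mF.
rewrite -product_measure1E; last 2 first.
- exact: mF.
- rewrite (_ : [set _ | _] =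
      \bigcap_(i : 'I_m) (@tnth m (measurableTypeR R) ^~ i @^-1` F (lift ord0 i))).
    apply: fin_bigcap_measurable => [|i _]; first exact: finite_finset.
    rewrite -[X in measurable X]setTI.
    exact: (measurable_tnth i) (mF (lift ord0 i)).
  by apply/seteqP; split=> t /= H i; [move=> _|]; exact: H.
congr (_ _); apply/seteqP; split => -[x t] /= H; first split.
- exact: (H ord0).
- by move=> i; have := H (lift ord0 i); rewrite tnthS.
- case: H => Hx Ht i; have [->//|i0] := eqVneq i ord0.
  by move: (Ht); case: (unliftP ord0 i) i0 => [j ->|->]; rewrite ?eqxx// tnthS.
Qed.

Definition colvec (R : realType) (m : nat) (t : m.-tuple (measurableTypeR R)) :
    'cV[R]_m :=
  \col_i (tnth t i : R).

(* For xi = D *m eta with eta ~ N(0, I_m): E is an event for xi and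
   Prob_xi(E) >= p. *)
Definition noise_prob_ge (R : realType) (m : nat) (D : 'M[R]_m)
    (E : set 'cV[R]_m) (p : R) : Prop :=
  let E' := [set t | E (D *m colvec t)] in
  measurable E' /\ (p%:E <= std_gaussian R m E')%E.

(* Main.v *)
Require Import Defs.
From HB Require Import structures.
From mathcomp Require Import all_boot all_order all_algebra.
From mathcomp Require Import all_classical all_reals all_analysis.
From mathcomp Require Import measurable_realfun ring lra.
Import Order.TTheory GRing.Theory Num.Theory.
Import numFieldNormedType.Exports.
Local Open Scope classical_set_scope.
Local Open Scope ring_scope.

(** The recovery guarantee is turned into an inequality on [B], and the
    inequality into the pair (H, V) by duality.

    Let [A x = u + D e] with [u] in [U].  The signals [x] and [-x], observed
    with the uncertainties [-u] and [u], give the observations [D (e + eta)]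
    and [D (- e + eta)], that is, the same random vector shifted by [e] and by
    [- e].  If [B x] were longer than the recovery tolerance, the recovered
    signal would tell the two shifts apart with both error probabilities at
    most [eps].  A test between two standard Gaussian laws centered at [e] and
    [- e] has total error at least twice the normal tail at [norm2 e]
    ([two_point_test]), so this is impossible as soon as
    [norm2 e < ErfInv eps].  Working with the radius [ErfInv eps / 2] keeps
    the inequality strict, at the price of the factor 2 of (c).  Hence
    [`|B x| <= alpha + S^-1 * L1 (B x)] for all such [x] ([recovery_bound]).

    By homogeneity the functional [x |-> (B x)_i] is dominated by a sublinear
    function of the pair [(B x, A x)]: [S^-1 * L1] of the first component, plus
    [alpha] times the gauge of [U + D (ball)] at the second one.  This gauge
    is finite because that set is a neighborhood of the origin.  Extending the
    functional from the range of [x |-> (B x, A x)] to the whole space under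
    the same bound ([riesz_extension]) gives vectors [v], [h] with
    [row i B = v^T B + h^T A] ([row_certificate]): they are row [i] of [V] and
    column [i] of [H].  The bound on [v] gives (b).  The bound on [h] is the
    estimate of the support function of [U] plus [ErfInv eps / 2] times
    [norm2 (D^T h)] by [alpha], and it gives (c) once [ErfInv eps] is replaced
    with the larger [ErfInv (eps / (2 N))].

    The probability statement of (c) is a union bound over the [N] columns,
    [xi^T h] being normal with standard deviation [norm2 (D^T h)]
    ([ge0_integral_linform]). *)

(** * Integrals against the normal law *)

Section normal_law.
Context {R : realType}.
Local Notation T := (measurableTypeR R).
Local Notation mu := (@lebesgue_measure R).
Local Notation nu := (normal_prob (0 : R) 1).
Local Open Scope ereal_scope.

Lemma ge0_integral_normal_prob (m s : R) (f : R -> \bar R) :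
  measurable_fun [set: R] f -> (forall x, 0 <= f x) ->
  \int[normal_prob m s]_x f x = \int[mu]_x (f x * (normal_pdf m s x)%:E).
Proof.
move=> mf f0.
have dom := normal_prob_dominates m s.
rewrite -(Radon_Nikodym_SigmaFinite.change_of_variables dom)//.
have fi := Radon_Nikodym_SigmaFinite.f_integrable dom.
have mp : measurable_fun [set: R] (EFin \o normal_pdf m s).
  by apply/measurable_EFinP; exact: measurable_normal_pdf.
apply: ae_eq_integral => //.
- by apply: emeasurable_funM => //; exact: measurable_int fi.
- exact: emeasurable_funM.
- apply: ae_eqe_mul2l => /=; apply: integral_ae_eq => //.
  by move=> E _ mE; rewrite -Radon_Nikodym_SigmaFinite.f_integral.
Qed.

Lemma ge0_integral_affine (a b : R) (f : R -> \bar R) : (0 < a)%R ->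
  measurable_fun [set: R] f -> (forall x, 0 <= f x) ->
  \int[mu]_x f (a * x + b)%R = a^-1%:E * \int[mu]_x f x.
Proof.
move=> a0 mf f0.
pose phi : T -> T := fun x => (a * x + b)%R.
have mphi : measurable_fun [set: T] phi.
  by apply: measurable_funD => //; exact: measurable_funM.
have a'0 : (0 <= a)%R by exact: ltW.
pose c : {nonneg R} := NngNum a'0.
(* Both sides of E are measures in A, so intervals suffice. *)
have E : forall A : set T, measurable A -> mu A = pushforward (mscale c mu) phi A.
  apply: lebesgue_measure_unique => // _ [[x y] _ <-].
  transitivity (a%:E * mu (phi @^-1` `]x, y]%classic)); last by [].
  have -> : phi @^-1` `]x, y]%classic =
      `]((x - b) / a)%R, ((y - b) / a)%R]%classic.
    apply/seteqP; split => z; rewrite /= !in_itv/= /phi;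
      by rewrite ler_pdivlMr// ltr_pdivrMr// ltrBlDr lerBrDr mulrC.
  rewrite !lebesgue_measure_itv/= !lte_fin ltr_pM2r ?invr_gt0// ltrD2r.
  case: ifPn => // _; last by rewrite mule0.
  by rewrite !EFinN -!EFinB -EFinM; congr EFin; field; rewrite gt_eqF.
have -> : \int[mu]_x f x = \int[pushforward (mscale c mu) phi]_x f x.
  by apply: eq_measure_integral => A mA _; exact: E.
rewrite ge0_integral_pushforward// ge0_integral_mscale//=.
- by rewrite preimage_setT muleA -EFinM mulVf ?gt_eqF// mul1e.
- by rewrite preimage_setT.
- by rewrite preimage_setT; exact: measurableT_comp.
Qed.

Lemma normal_pdf1E (x : R) :
  normal_pdf 0 1 x = (normal_peak 1 * expR (- (x ^+ 2 / 2)))%R.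
Proof. by rewrite normal_pdfE ?oner_eq0// /normal_fun subr0 expr1n mulNr. Qed.

(** The shift is moved from the function to the density, and the ratio of the
    two densities is an exponential. *)
Lemma ge0_integral_normal_prob_shift (a : R) (f : R -> \bar R) :
  measurable_fun [set: R] f -> (forall x, 0 <= f x) ->
  \int[nu]_x f (x + a)%R =
  \int[nu]_x (f x * (expR (a * x - a ^+ 2 / 2))%:E).
Proof.
move=> mf f0.
have mS (c : R) : measurable_fun [set: R] (fun x : R => x + c)%R.
  exact: measurable_funD.
have mp (c : R) : measurable_fun [set: R] (fun x => (normal_pdf 0 1 (x + c))%:E).
  by apply/measurable_EFinP/measurableT_comp => //; exact: measurable_normal_pdf.
rewrite ge0_integral_normal_prob//; last exact: (measurableT_comp mf).
rewrite ge0_integral_normal_prob//; last first.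
- by move=> x; rewrite mule_ge0// lee_fin expR_ge0.
- apply: emeasurable_funM => //; apply/measurable_EFinP/measurableT_comp => //.
  by apply: measurable_funB => //; exact: measurable_funM.
pose g x := f x * (normal_pdf 0 1 (x - a))%:E.
have := @ge0_integral_affine 1 a g ltr01.
rewrite invr1 mul1e => E.
transitivity (\int[mu]_x g (1 * x + a)%R).
  by apply: eq_integral => x _; rewrite /g mul1r addrK.
rewrite {}E; first last.
- by move=> x; rewrite mule_ge0// lee_fin normal_pdf_ge0.
- exact: emeasurable_funM.
apply: eq_integral => x _; rewrite /g -muleA -EFinM; congr (_ * _%:E).
rewrite !normal_pdf1E mulrCA -expRD; congr (_ * expR _)%R.
by field.
Qed.

Lemma ge0_integral_normal_prob_opp (f : R -> \bar R) :
  measurable_fun [set: R] f -> (forall x, 0 <= f x) ->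
  \int[nu]_x f (- x)%R = \int[nu]_x f x.
Proof.
move=> mf f0.
have mp : measurable_fun [set: R] (fun x => (normal_pdf 0 1 x : R)%:E).
  by apply/measurable_EFinP; exact: measurable_normal_pdf.
pose opp : T -> T := -%R.
have mN : measurable_fun [set: T] opp by exact: oppr_measurable.
rewrite ge0_integral_normal_prob//; last exact: (measurableT_comp mf).
rewrite ge0_integral_normal_prob//.
transitivity (\int[pushforward mu opp]_x
    (f x * (normal_pdf 0 1 x)%:E)).
  rewrite ge0_integral_pushforward; last 4 first.
  - exact: mN.
  - exact: measurableT.
  - by apply: emeasurable_funM.
  - by move=> x _; rewrite mule_ge0// lee_fin normal_pdf_ge0.
  rewrite preimage_setT; apply: eq_integral => x _ /=.
  by rewrite !normal_pdf1E sqrrN.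
by apply: eq_measure_integral => A mA _; exact: lebesgue_measureN.
Qed.

(** The joint density of two independent standard normal variables is invariant
    under the rotation with cosine [a] and sine [b]: the left side is the
    density of (a X + b Y, X), the right side factors it as the density of
    a X + b Y times the conditional density of X. *)
Lemma normal_pdf_rotation (a b x z : R) : (0 < b)%R -> (a ^+ 2 + b ^+ 2 = 1)%R ->
  (b^-1 * normal_pdf 0 1 ((z - a * x) / b) * normal_pdf 0 1 x =
   normal_pdf 0 1 z * normal_pdf (a * z) b x)%R.
Proof.
move=> b0 ab; rewrite !normal_pdf1E normal_pdfE ?gt_eqF//.
have -> : normal_peak b = (b^-1 * normal_peak 1)%R.
  rewrite /normal_peak expr1n mul1r -mulrnAr sqrtrM ?sqr_ge0// sqrtr_sqr.
  by rewrite gtr0_norm// invfM.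
have b_neq0 : (b != 0)%R by rewrite gt_eqF.
transitivity (b^-1 * normal_peak 1 * normal_peak 1 *
  (expR (- (((z - a * x) / b) ^+ 2 / 2)) * expR (- (x ^+ 2 / 2))))%R; first by ring.
transitivity (b^-1 * normal_peak 1 * normal_peak 1 *
  (expR (- (z ^+ 2 / 2)) * normal_fun (a * z) b x))%R; last by ring.
congr (_ * _)%R; rewrite /normal_fun -!expRD; congr expR.
apply/eqP; rewrite -subr_eq0; apply/eqP.
transitivity ((a ^+ 2 + b ^+ 2 - 1) * (z ^+ 2 - x ^+ 2) / b ^+ 2 / 2)%R.
  by rewrite -mulr_natr; field.
by rewrite ab subrr !mul0r.
Qed.

(** After the substitution z = a x + b y in the inner integral, Tonelli and the
    factorization of the joint density let the integral in x be evaluated. *)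
Lemma ge0_integral_normal_prob_rotation (a b : R) (f : R -> \bar R) :
  (0 < b)%R -> (a ^+ 2 + b ^+ 2 = 1)%R ->
  measurable_fun [set: R] f -> (forall x, 0 <= f x) ->
  \int[nu]_x \int[nu]_y f (a * x + b * y)%R = \int[nu]_x f x.
Proof.
move=> b0 ab mf f0.
have b'0 : (0 <= b^-1)%R by rewrite invr_ge0 ltW.
have mp (d : measure_display) (X : measurableType d) (g : X -> R) (m s : R) :
    measurable_fun [set: X] g ->
    measurable_fun [set: X] (fun x => (normal_pdf m s (g x))%:E).
  by move=> mg; apply/measurable_EFinP/measurableT_comp => //;
     exact: measurable_normal_pdf.
pose h (p : R * R) := f p.2 *
  (b^-1 * normal_pdf 0 1 ((p.2 - a * p.1) / b) * normal_pdf 0 1 p.1)%:E.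
have h0 p : 0 <= h p.
  by rewrite mule_ge0// lee_fin !mulr_ge0// normal_pdf_ge0.
have mh : measurable_fun [set: R * R] h.
  apply: emeasurable_funM; first exact: measurableT_comp.
  apply/measurable_EFinP/measurable_funM.
    apply: measurable_funM => //.
    apply: (measurableT_comp (measurable_normal_pdf 0 1)).
    apply: measurable_funM => //; apply: measurable_funB => //.
    exact: measurable_funM.
  exact: (measurableT_comp (measurable_normal_pdf 0 1)).
have inner x : (\int[nu]_y f (a * x + b * y)%R) * (normal_pdf 0 1 x)%:E =
    \int[mu]_z h (x, z).
  rewrite ge0_integral_normal_prob//; last first.
    apply: (measurableT_comp mf).
    by apply: measurable_funD => //; exact: measurable_funM.
  pose k z := f z * (normal_pdf 0 1 ((z - a * x) / b))%:E.
  have k0 z : 0 <= k z by rewrite mule_ge0// lee_fin normal_pdf_ge0.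
  have mk : measurable_fun [set: R] k.
    apply: emeasurable_funM => //; apply: mp.
    by apply: measurable_funM => //; exact: measurable_funB.
  have -> : \int[mu]_y (f (a * x + b * y)%R * (normal_pdf 0 1 y)%:E) =
      \int[mu]_y k (b * y + a * x)%R.
    apply: eq_integral => y _.
    have -> : (a * x + b * y = b * y + a * x)%R by exact: addrC.
    have yE : ((b * y + a * x - a * x) / b = y)%R.
      by rewrite addrK mulrAC divff ?gt_eqF// mul1r.
    by rewrite /k yE.
  rewrite ge0_integral_affine// muleC muleA -EFinM -ge0_integralZl//; last first.
    by rewrite lee_fin mulr_ge0// normal_pdf_ge0.
  apply: eq_integral => z _; rewrite /k /h /=.
  by rewrite muleCA; congr (_ * _); rewrite -EFinM; congr EFin; ring.
rewrite ge0_integral_normal_prob//; last 2 first.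
- have mg : measurable_fun [set: T * T] (fun p : T * T => f (a * p.1 + b * p.2)%R).
    apply: (measurableT_comp mf).
    by apply: measurable_funD => //; exact: measurable_funM.
  exact: (measurable_fun_fubini_tonelli_F (m2 := nu) _ mg).
- by move=> x; exact: integral_ge0.
under eq_integral do rewrite inner.
rewrite (fubini_tonelli (m1 := mu) (m2 := mu) h)//=.
rewrite ge0_integral_normal_prob//; apply: eq_integral => z _.
rewrite /h /=.
under eq_integral do rewrite normal_pdf_rotation// EFinM muleA.
rewrite ge0_integralZl//; last 3 first.
- exact: mp.
- by move=> x _; rewrite lee_fin normal_pdf_ge0.
- by rewrite mule_ge0// lee_fin normal_pdf_ge0.
by rewrite integral_normal_pdf mule1.
Qed.

Lemma ge0_integral_normal_prob_comb (a b : R) (f : R -> \bar R) :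
  (0 <= b)%R -> measurable_fun [set: R] f -> (forall x, 0 <= f x) ->
  \int[nu]_x \int[nu]_y f (a * x + b * y)%R =
  \int[nu]_x f (Num.sqrt (a ^+ 2 + b ^+ 2) * x)%R.
Proof.
move=> b0 mf f0; have [b00|b_neq0] := eqVneq b 0%R.
  rewrite b00 expr0n addr0 sqrtr_sqr.
  under eq_integral => x _.
    under eq_integral do rewrite mul0r addr0.
    rewrite integral_cst//= probability_setT mule1.
    over.
  have [a0|a0] := ger0P a => //.
  rewrite -[LHS]ge0_integral_normal_prob_opp//; last first.
    by apply: (measurableT_comp mf); exact: measurable_funM.
  by apply: eq_integral => x _; rewrite mulrN mulNr.
have s0 : (0 < a ^+ 2 + b ^+ 2)%R.
  by rewrite ltr_wpDl ?sqr_ge0// exprn_even_gt0.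
set s := Num.sqrt _; have s'0 : (0 < s)%R by rewrite sqrtr_gt0.
rewrite -(@ge0_integral_normal_prob_rotation (a / s) (b / s)
  (fun x => f (s * x)%R)).
- apply: eq_integral => x _; apply: eq_integral => y _; congr f.
  by field; rewrite gt_eqF.
- by rewrite divr_gt0// lt_neqAle eq_sym b_neq0.
- by rewrite !expr_div_n -mulrDl sqr_sqrtr ?ltW// divff// gt_eqF.
- by apply: (measurableT_comp mf); exact: measurable_funM.
- by [].
Qed.

End normal_law.

(** * Standard Gaussian vectors *)

Section gaussian_vectors.
Context {R : realType}.
Local Notation T := (measurableTypeR R).
Local Notation mu := (@lebesgue_measure R).
Local Notation nu := (normal_prob (0 : R) 1).
Local Notation gam := (std_gaussian R).

Definition linform {m} (g : 'I_m -> R) (t : m.-tuple T) : R :=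
  \sum_i g i * (tnth t i : R).

Definition translate {m} (e : 'I_m -> R) (t : m.-tuple T) : m.-tuple T :=
  [tuple ((tnth t i : R) + e i : T) | i < m].

Lemma measurable_linform {m} (g : 'I_m -> R) :
  measurable_fun [set: m.-tuple T] (linform g : m.-tuple T -> R).
Proof.
apply: measurable_sum => i; apply: measurable_funM => //.
exact: measurable_tnth.
Qed.

Lemma measurable_translate {m} (e : 'I_m -> R) :
  measurable_fun [set: m.-tuple T] (translate e).
Proof.
apply/measurable_fun_tnthP => i.
have -> : (@tnth m T ^~ i) \o translate e =
    (fun t : m.-tuple T => (tnth t i : R) + e i)%R.
  by apply/funext => t /=; rewrite tnth_mktuple.
by apply: measurable_funD => //; exact: measurable_tnth.
Qed.

Lemma linform_cons {m} (g : 'I_m.+1 -> R) x (t : m.-tuple T) :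
  linform g (cons_pair (x, t)) =
  g ord0 * x + linform (g \o lift ord0) t.
Proof.
rewrite /linform big_ord_recl; congr (_ + _).
by apply: eq_bigr => i _; rewrite tnthS.
Qed.

Lemma translate_cons {m} (e : 'I_m.+1 -> R) x (t : m.-tuple T) :
  translate e (cons_pair (x, t)) =
  cons_pair (x + e ord0, translate (e \o lift ord0) t).
Proof.
apply: eq_from_tnth => i; rewrite tnth_mktuple.
by case: (unliftP ord0 i) => [j ->|->]; rewrite ?tnthS ?tnth_mktuple.
Qed.

Lemma ge0_integral_std_gaussianS {m} (F : m.+1.-tuple T -> \bar R) :
  measurable_fun [set: m.+1.-tuple T] F -> (forall t, 0 <= F t)%E ->
  (\int[gam m.+1]_t F t =
   \int[nu]_x \int[gam m]_t F (cons_pair (x, t)))%E.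
Proof.
move=> mF F0; rewrite /= ge0_integral_distribution//.
rewrite (fubini_tonelli1 (m1 := nu) (m2 := gam m) (F \o @cons_pair R m))//.
  exact: (measurableT_comp mF (@measurable_cons_pair R m)).
by move=> x; exact: F0.
Qed.

(** A linear form [g] of a standard Gaussian vector is normal with standard
    deviation the Euclidean norm of [g]: one coordinate at a time, two
    independent normal variables are merged into one. *)
Lemma ge0_integral_linform {m} (g : 'I_m -> R) (f : R -> \bar R) :
  measurable_fun [set: R] f -> (forall x, 0 <= f x)%E ->
  (\int[gam m]_t f (linform g t) =
   \int[nu]_z f (Num.sqrt (\sum_i g i ^+ 2) * z)%R)%E.
Proof.
elim: m g f => [|m IH] g f mf f0.
  under [RHS]eq_integral do rewrite big_ord0 sqrtr0 mul0r.
  rewrite integral_cst//= probability_setT mule1.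
  rewrite integral_dirac//= ?diracT ?mul1e; first by rewrite /linform big_ord0.
  exact: (measurableT_comp mf (measurable_linform g)).
rewrite ge0_integral_std_gaussianS//; last first.
  exact: (measurableT_comp mf (measurable_linform g)).
under eq_integral => x _.
  under eq_integral do rewrite linform_cons.
  rewrite (IH _ (fun r => f (g ord0 * x + r)%R))//; last first.
    by apply: (measurableT_comp mf); exact: measurable_funD.
  over.
rewrite ge0_integral_normal_prob_comb ?sqrtr_ge0//.
rewrite sqr_sqrtr; last by apply: sumr_ge0 => i _; exact: sqr_ge0.
by rewrite big_ord_recl.
Qed.

(** Cameron-Martin formula, obtained coordinate by coordinate from the
    one-dimensional shift. *)
Lemma ge0_integral_translate {m} (e : 'I_m -> R) (F : m.-tuple T -> \bar R) :
  measurable_fun [set: m.-tuple T] F -> (forall t, 0 <= F t)%E ->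
  (\int[gam m]_t F (translate e t) =
   \int[gam m]_t (F t *
     (expR (linform e t - (\sum_i e i ^+ 2) / 2))%:E))%E.
Proof.
elim: m e F => [|m IH] e F mF F0.
  apply: eq_integral => t _; rewrite /linform !big_ord0 mul0r subr0 expR0 mule1.
  by congr F; apply: eq_from_tnth => -[].
pose e' := e \o lift ord0.
pose L (c : R) n (u : 'I_n -> R) (t : n.-tuple T) : R := expR (linform u t - c).
have mL c n (u : 'I_n -> R) : measurable_fun [set: n.-tuple T] (EFin \o L c n u).
  apply/measurable_EFinP/measurableT_comp => //; apply: measurable_funB => //.
  exact: measurable_linform.
pose c' := (\sum_i e' i ^+ 2) / 2.
(* h is F with all coordinates but the first one already shifted. *)
pose h x := (\int[gam m]_t (F (cons_pair (x, t)) * (L c' m e' t)%:E))%E.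
have mFc x : measurable_fun [set: m.-tuple T] (fun t => F (cons_pair (x, t))).
  apply: (measurableT_comp mF).
  apply: (measurableT_comp (@measurable_cons_pair R m)).
  exact: measurable_fun_pair.
have mh : measurable_fun [set: R] h.
  apply: (measurable_fun_fubini_tonelli_F (m2 := gam m)
    (fun p : T * m.-tuple T => F (cons_pair p) * (L c' m e' p.2)%:E)%E).
  - apply: emeasurable_funM.
      exact: (measurableT_comp mF (@measurable_cons_pair R m)).
    exact: (measurableT_comp (mL c' m e') measurable_snd).
  - by move=> p; rewrite mule_ge0// lee_fin expR_ge0.
have h0 x : (0 <= h x)%E.
  by apply: integral_ge0 => t _; rewrite mule_ge0// lee_fin expR_ge0.
rewrite ge0_integral_std_gaussianS//; last first.
  exact: (measurableT_comp mF (measurable_translate e)).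
transitivity (\int[nu]_x h (x + e ord0)%R)%E.
  apply: eq_integral => x _; under eq_integral do rewrite translate_cons.
  by rewrite (IH _ (fun t => F (cons_pair (x + e ord0, t))%R)).
rewrite ge0_integral_normal_prob_shift// ge0_integral_std_gaussianS; last 2 first.
- by apply: emeasurable_funM => //; exact: mL.
- by move=> t; rewrite mule_ge0// lee_fin expR_ge0.
apply: eq_integral => x _; rewrite /h muleC -ge0_integralZl//.
- apply: eq_integral => t _; rewrite muleCA; congr (_ * _)%E.
  rewrite -EFinM; congr EFin; rewrite /L -expRD; congr expR.
  by rewrite linform_cons big_ord_recl /c' /e' /=; field.
- by apply: emeasurable_funM => //; exact: mL.
- by move=> t _; rewrite mule_ge0// lee_fin expR_ge0.
Qed.

End gaussian_vectors.

(** * Tails of the normal law and their inverse *)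

Section gaussian_tail.
Context {R : realType}.
Local Notation T := (measurableTypeR R).
Local Notation mu := (@lebesgue_measure R).
Local Notation nu := (normal_prob (0 : R) 1).

Definition gauss_tail (t : R) : R := fine (nu `[t, +oo[).

Let nu_fin (A : set T) : measurable A -> nu A \is a fin_num.
Proof. by move=> mA; exact: fin_num_measure. Qed.

Lemma gauss_tailE t : (gauss_tail t)%:E = nu `[t, +oo[.
Proof. by rewrite /gauss_tail fineK// nu_fin. Qed.

Let mpdf D : measurable_fun D (EFin \o normal_pdf (0 : R) 1).
Proof.
by apply/measurable_funTS/measurable_EFinP; exact: measurable_normal_pdf.
Qed.

Lemma gauss_tail_lt : {homo gauss_tail : s t / (t < s)%R >-> (s < t)%R}.
Proof.
move=> t s st; rewrite -lte_fin !gauss_tailE.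
have -> : `[s, +oo[%classic = `[s, t[ `|` `[t, +oo[ :> set T.
  by rewrite -itv_bndbnd_setU// bnd_simp ltW.
rewrite measureU//; last first.
  rewrite -subset0 => x [] /=; rewrite !in_itv/= andbT => /andP[_ xt].
  by rewrite leNgt xt.
rewrite -[ltLHS]add0e lteD2rE ?nu_fin//.
(* A lower bound of the density on [s, t]: x ^+ 2 <= s ^+ 2 + t ^+ 2 there. *)
pose c := normal_peak 1 * expR (- ((s ^+ 2 + t ^+ 2) / 2)) : R.
have c0 : 0 < c by rewrite mulr_gt0 ?expR_gt0// normal_peak_gt0// oner_eq0.
have : (\int[mu]_(x in `[s, t[) c%:E <= nu `[s, t[)%E.
  apply: ge0_le_integral => //=.
  - by move=> x _; exact: ltW.
  - exact: mpdf.
  move=> x; rewrite in_itv/= => /andP[sx xt].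
  rewrite lee_fin normal_pdf1E ler_pM2l ?normal_peak_gt0 ?oner_eq0//.
  by rewrite ler_expR lerN2 ler_pM2r//; have [x0|x0] := lerP 0 x; nra.
apply: lt_le_trans.
rewrite integral_cst//= lebesgue_measure_itv/= lte_fin st -EFinD -EFinM lte_fin.
by rewrite mulr_gt0// subr_gt0.
Qed.

Lemma gauss_tail_le : {mono gauss_tail : s t / (t <= s)%R >-> (s <= t)%R}.
Proof. exact: le_nmono gauss_tail_lt. Qed.

Let nu_set1 t : nu [set t] = 0%E.
Proof.
have /null_content_dominatesP := normal_prob_dominates (0 : R) 1.
by apply => //; exact: lebesgue_measure_set1.
Qed.

Lemma normal_prob_lt t : nu `]-oo, t[ = (1 - gauss_tail t)%:E.
Proof.
rewrite EFinB gauss_tailE -(setCitvr (BLeft t)) probability_setC//.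
Qed.

Lemma normal_prob_le t : nu `]-oo, t] = (1 - gauss_tail t)%:E.
Proof.
rewrite -normal_prob_lt -(@setUitv1 _ _ -oo%O t true)// measureU//; last first.
  by rewrite -subset0 => x [] /= /[swap] ->; rewrite in_itv/= ltxx.
by rewrite [X in (_ + X)%E](nu_set1 t) adde0.
Qed.

Lemma gauss_tailN t : gauss_tail (- t) = 1 - gauss_tail t.
Proof.
apply: EFin_inj; rewrite -normal_prob_le gauss_tailE.
have E (A : set T) : measurable A -> nu A = (\int[nu]_x (\1_A x)%:E)%E.
  by move=> mA; rewrite integral_indic// setIT.
rewrite !E// -ge0_integral_normal_prob_opp//; last first.
  by apply/measurable_EFinP; exact: measurable_indic.
apply: eq_integral => x _; rewrite !indicE; congr ((_ : bool)%:R%:E).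
by apply/idP/idP; rewrite !inE/= !in_itv/= andbT lerN2.
Qed.

Lemma gauss_tail0 : gauss_tail 0 = 1 / 2.
Proof. by have := gauss_tailN 0; rewrite oppr0; lra. Qed.

Let F (x : R) : R := (\int[mu]_(t in `]-oo, x]) (normal_pdf 0 1 t))%R.

Let F_tail x : gauss_tail x = 1 - F x.
Proof.
have -> : F x = fine (nu `]-oo, x]) by [].
by rewrite normal_prob_le/= subKr.
Qed.

Let F_continuous : continuous F.
Proof.
move=> x; apply: differentiable_continuous; apply/derivable1_diffP.
have xS : x < x + 1 by rewrite ltrDl.
have intf : mu.-integrable `]-oo, (x + 1)] (EFin \o normal_pdf 0 1).
  exact: integrableS (integrable_normal_pdf 0 1).
have cf : {for x, continuous (normal_pdf (0 : R) 1)}.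
  exact: continuous_normal_pdf (oner_neq0 _) _.
by have [] := continuous_FTC1 xS intf (ltNyr x) cf.
Qed.

(** Intermediate value theorem for the distribution function, which is
    continuous because the law has a density. *)
Lemma gauss_tail_surj (d : R) : 0 < d -> d < 1 -> exists t, gauss_tail t = d.
Proof.
move=> d0 d1.
pose X : T -> R := idfun.
have mX : measurable_fun [set: T] X by exact: measurable_id.
pose Y : {mfun T >-> R} := HB.pack X (isMeasurableFun.Build _ _ _ _ X mX).
have cdfE r : cdf (Y : {RV nu >-> R}) r = (F r)%:E.
  by rewrite /F /Rintegral fineK ?nu_fin.
have FE : F = fine \o cdf (Y : {RV nu >-> R}).
  by apply/funext => r; rewrite -[LHS]/(fine (F r)%:E) -cdfE.
have [a aP] : exists a, F a < 1 - d.
  have FNy : F x @[x --> -oo] --> (0 : R).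
    by rewrite FE; apply: fine_cvg; exact: cvg_cdfNy0.
  have d'0 : 0 < 1 - d by rewrite subr_gt0.
  exact: (@filter_ex _ _ _ _ (cvgr_lt _ FNy _ d'0)).
have [b bP] : exists b, 1 - d < F b.
  have Fy : F x @[x --> +oo] --> (1 : R).
    by rewrite FE; apply: fine_cvg; exact: cvg_cdfy1.
  have d'1 : 1 - d < 1 by rewrite gtrBl.
  exact: (@filter_ex _ _ _ _ (cvgr_gt _ Fy _ d'1)).
have ab : a <= b by rewrite -gauss_tail_le !F_tail; lra.
have [||c _ cE] := @IVT R F a b (1 - d) ab.
- by apply: continuous_subspaceT; exact: F_continuous.
- by rewrite ge_min le_max (ltW aP) (ltW bP) orbT.
by exists c; rewrite F_tail cE subKr.
Qed.

(** The value of [xget] in the definition of [ErfInv] is a solution, since one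
    exists. *)
Lemma gauss_tail_ErfInv (d : R) : 0 < d -> d < 1 -> gauss_tail (ErfInv d) = d.
Proof.
move=> d0 d1.
have H t : ((Num.sqrt (2 * pi))^-1%:E *
      \int[mu]_(tau in `[t, +oo[) (expR (- tau ^+ 2 / 2))%:E = nu `[t, +oo[)%E.
  rewrite -ge0_integralZl//.
  - rewrite /normal_prob; apply: eq_integral => x _.
    rewrite normal_pdf1E /normal_peak expr1n mul1r mulNr -EFinM.
    by rewrite -[(pi *+ 2)%R]mulr_natl.
  - apply/measurable_funTS/measurable_EFinP/measurableT_comp => //.
    by apply: measurable_funM => //; exact: measurableT_comp.
rewrite /ErfInv; case: xgetP => [t _ /= |].
  by rewrite H -gauss_tailE => -[].
have [t tE] := gauss_tail_surj _ d0 d1.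
by move=> /(_ t) []; rewrite /= H -gauss_tailE tE.
Qed.

End gaussian_tail.

Lemma ErfInv_gt0 {R : realType} (eps : R) :
  0 < eps -> eps < 1 / 2 -> 0 < ErfInv eps.
Proof.
move=> eps0 eps_lt; have eps1 : eps < 1 by lra.
by rewrite ltNge -gauss_tail_le gauss_tail_ErfInv// gauss_tail0 -ltNge.
Qed.

Lemma ErfInv_le {R : realType} (d d' : R) : 0 < d -> d <= d' -> d' < 1 ->
  ErfInv d' <= ErfInv d.
Proof.
move=> d0 dd' d'1; have d1 := le_lt_trans dd' d'1.
by rewrite -gauss_tail_le !gauss_tail_ErfInv//; exact: lt_le_trans dd'.
Qed.

(** * Linear forms and testing between two shifts *)

Section gaussian_testing.
Context {R : realType}.
Local Notation T := (measurableTypeR R).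
Local Notation nu := (normal_prob (0 : R) 1).
Local Notation gam := (std_gaussian R).
Local Notation eucl g := (Num.sqrt (\sum_i g i ^+ 2)).

Lemma measurable_preimage_linform {m} (g : 'I_m -> R) (A : set R) :
  measurable A -> measurable (linform g @^-1` A).
Proof.
by move=> mA; rewrite -[X in measurable X]setTI; exact: measurable_linform.
Qed.

Lemma measurable_preimage_translate {m} (e : 'I_m -> R) (A : set (m.-tuple T)) :
  measurable A -> measurable (translate e @^-1` A).
Proof.
by move=> mA; rewrite -[X in measurable X]setTI; exact: measurable_translate.
Qed.

Lemma std_gaussian_linform {m} (g : 'I_m -> R) (A : set R) : measurable A ->
  gam m (linform g @^-1` A) = nu ( *%R (eucl g) @^-1` A).
Proof.
move=> mA.
have mB : measurable ( *%R (eucl g) @^-1` A : set T).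
  rewrite -[X in measurable X]setTI.
  by have : measurable_fun [set: R] ( *%R (eucl g)) by []; exact.
rewrite -[LHS]/(gam m (linform g @^-1` A)) -[in LHS](setIT (_ @^-1` A)).
rewrite -integral_indic//; last exact: measurable_preimage_linform.
rewrite (ge0_integral_linform g (fun x => (\1_A x)%:E))//; last first.
  by apply/measurable_EFinP; exact: measurable_indic.
by rewrite -[in RHS](setIT (_ @^-1` A)) -integral_indic.
Qed.

Lemma linform_eq0 {m} (g : 'I_m -> R) (t : m.-tuple T) :
  eucl g = 0 -> linform g t = 0.
Proof.
move=> s0; have : \sum_i g i ^+ 2 == 0.
  rewrite eq_le sumr_ge0 ?andbT => [|j _]; last exact: sqr_ge0.
  by rewrite -sqrtr_eq0 s0.
rewrite psumr_eq0 => [/allP g0|j _]; last exact: sqr_ge0.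
rewrite /linform big1// => i _; have := g0 i (mem_index_enum _).
by rewrite /= sqrf_eq0 => /eqP ->; rewrite mul0r.
Qed.

Lemma std_gaussian_linform_tail {m} (g : 'I_m -> R) (c : R) : 0 < eucl g ->
  gam m (linform g @^-1` `[c * eucl g, +oo[) = (gauss_tail c)%:E.
Proof.
move=> s0; rewrite std_gaussian_linform// gauss_tailE; congr (nu _).
by apply/seteqP; split => x /=; rewrite !in_itv/= !andbT mulrC ler_pM2l.
Qed.

Lemma measurable_linform_norm_gt {m} (g : 'I_m -> R) (a : R) :
  measurable [set t | a < `|linform g t|].
Proof.
have -> : [set t | a < `|linform g t|] = linform g @^-1` [set x | a < `|x|] by [].
apply: measurable_preimage_linform; rewrite -[X in measurable X]setTI.
have -> : [set x : R | a < `|x|] = Num.norm @^-1` `]a, +oo[.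
  by apply/seteqP; split => x /=; rewrite in_itv/= andbT.
by have : measurable_fun [set: R] (Num.norm : R -> R) by []; exact.
Qed.

Lemma std_gaussian_linform_norm {m} (g : 'I_m -> R) (c : R) : 0 <= c ->
  (gam m [set t | (c * eucl g < `|linform g t|)%R] <= (2 * gauss_tail c)%:E)%E.
Proof.
move=> c0.
have := sqrtr_ge0 (\sum_i g i ^+ 2).
rewrite le_eqVlt => /orP[/eqP s0|s0].
  rewrite (_ : [set _ | _] = set0); last first.
    rewrite -subset0 => t /=; rewrite -s0 mulr0 normr_gt0 => /negP; apply.
    by apply/eqP; exact: linform_eq0.
  by rewrite measure0 lee_fin mulr_ge0// fine_ge0.
pose g' i := - g i.
have gE : eucl g' = eucl g.
  by congr Num.sqrt; apply: eq_bigr => i _; rewrite sqrrN.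
have linN t : linform g' t = - linform g t.
  by rewrite /linform -sumrN; apply: eq_bigr => i _; rewrite mulNr.
have mI (h : 'I_m -> R) : measurable (linform h @^-1` `[c * eucl g, +oo[).
  exact: measurable_preimage_linform.
apply: (@le_trans _ _ (gam m (linform g @^-1` `[c * eucl g, +oo[ `|`
                         linform g' @^-1` `[c * eucl g, +oo[))).
  apply: le_measure; rewrite ?inE.
  - exact: measurable_linform_norm_gt.
  - exact: measurableU.
  - move=> t /=; rewrite !in_itv/= !andbT linN lter_normr.
    by move=> /orP[/ltW|/ltW]; tauto.
have E' : gam m (linform g' @^-1` `[c * eucl g, +oo[) = (gauss_tail c)%:E.
  by rewrite -gE std_gaussian_linform_tail// gE.
have := measureU2 (gam m) (mI g) (mI g').
rewrite [X in (_ <= X + _)%E](std_gaussian_linform_tail _ _ s0).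
by rewrite [X in (_ <= _ + X)%E]E' -EFinD mulrDl mul1r.
Qed.

Lemma std_gaussian_translate {m} (e : 'I_m -> R) (A : set (m.-tuple T)) :
  measurable A -> gam m (translate e @^-1` A) =
  (\int[gam m]_t ((\1_A t)%:E *
     (expR (linform e t - (\sum_i e i ^+ 2) / 2))%:E))%E.
Proof.
move=> mA; rewrite -(ge0_integral_translate e (fun t => (\1_A t)%:E))//.
- rewrite -[in LHS](setIT (_ @^-1` _)) -integral_indic//.
  exact: measurable_preimage_translate.
- by apply/measurable_EFinP; exact: measurable_indic.
Qed.

(** The sum of the two probabilities is largest for the likelihood-ratio test:
    with complementary events it is an integral in which each point contributes
    the density of one of the two shifted laws, and the density of the law
    shifted by [e] is the larger one exactly on the half-space
    [0 <= linform e t]. *)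
Lemma two_point_test {m} (e e' : 'I_m -> R) (G G' : set (m.-tuple T)) :
  (forall i, e' i = - e i) -> measurable G -> measurable G' ->
  G `&` G' = set0 ->
  (gam m (translate e @^-1` G) + gam m (translate e' @^-1` G') <=
   (2 - 2 * gauss_tail (eucl e))%:E)%E.
Proof.
move=> e'E mG mG' GG'.
pose c := (\sum_i e i ^+ 2) / 2.
have linN t : linform e' t = - linform e t.
  by rewrite /linform -sumrN; apply: eq_bigr => i _; rewrite e'E mulNr.
have cE : (\sum_i e' i ^+ 2) / 2 = c.
  by congr (_ / _); apply: eq_bigr => i _; rewrite e'E sqrrN.
pose E : set (m.-tuple T) := linform e @^-1` `[0, +oo[.
have mE : measurable E by exact: measurable_preimage_linform.
pose J (A : set (m.-tuple T)) t : \bar R :=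
  ((\1_A t * expR (linform e t - c))%:E +
   (\1_(~` A) t * expR (- linform e t - c))%:E)%E.
have mterm (A : set (m.-tuple T)) (g : 'I_m -> R) (k : R) : measurable A ->
    measurable_fun [set: m.-tuple T]
      (fun t => (\1_A t)%:E * (expR (linform g t - k))%:E)%E.
  move=> mA; apply: emeasurable_funM.
    by apply/measurable_EFinP; exact: measurable_indic.
  apply/measurable_EFinP/measurableT_comp => //; apply: measurable_funB => //.
  exact: measurable_linform.
have term0 (A : set (m.-tuple T)) (g : 'I_m -> R) (k : R) t :
    (0 <= (\1_A t)%:E * (expR (linform g t - k))%:E)%E.
  by rewrite mule_ge0// lee_fin expR_ge0.
have sumE A : measurable A ->
    (gam m (translate e @^-1` A) + gam m (translate e' @^-1` (~` A)))%E =
    (\int[gam m]_t J A t)%E.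
  move=> mA; rewrite !std_gaussian_translate//; last exact: measurableC.
  rewrite -ge0_integralD.
  - by apply: eq_integral => t _; rewrite /J cE linN !EFinM.
  - exact: measurableT.
  - by move=> t _; exact: term0.
  - exact: mterm.
  - by move=> t _; exact: term0.
  - exact: (mterm (~` A) e' _ (measurableC mA)).
have J0 A t : (0 <= J A t)%E.
  by rewrite adde_ge0// lee_fin mulr_ge0// expR_ge0.
have mJ A : measurable A -> measurable_fun [set: m.-tuple T] (J A).
  move=> mA; apply: emeasurable_funD; first exact: (mterm A e c).
  have := mterm (~` A) e' c (measurableC mA).
  by apply: eq_measurable_fun => t _ /=; rewrite linN EFinM.
apply: (@le_trans _ _ (gam m (translate e @^-1` E) +
                       gam m (translate e' @^-1` (~` E)))%E).
  apply: (@le_trans _ _ (gam m (translate e @^-1` G) +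
                         gam m (translate e' @^-1` (~` G)))%E).
    rewrite leeD2l// le_measure ?inE//.
    - exact: measurable_preimage_translate.
    - by apply: measurable_preimage_translate; exact: measurableC.
    - move=> t /= G't Gt; have : (G `&` G') (translate e' t) by [].
      by rewrite GG'.
  rewrite !sumE//; apply: ge0_le_integral.
  - exact: measurableT.
  - by move=> t _; exact: J0.
  - exact: mJ.
  - exact: mJ.
  move=> t _; rewrite /J lee_fin !indicE !in_setC.
  have -> : (t \in E) = (0 <= linform e t).
    by rewrite /E; apply/idP/idP; rewrite inE /= in_itv /= andbT.
  have [et|et] := leP 0 (linform e t); have [tG|tG] := boolP (t \in G);
    rewrite /= ?mul0r ?mul1r ?addr0 ?add0r// ler_expR lerD2r; lra.
have sqE : eucl e * eucl e = \sum_i e i ^+ 2.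
  by rewrite -expr2 sqr_sqrtr// sumr_ge0// => i _; exact: sqr_ge0.
have trE t : linform e (translate e t) = linform e t + eucl e * eucl e.
  rewrite sqE /linform -big_split/=; apply: eq_bigr => i _.
  by rewrite tnth_mktuple mulrDr expr2.
have trE' t : linform e (translate e' t) = linform e t - eucl e * eucl e.
  rewrite sqE /linform -sumrB; apply: eq_bigr => i _.
  by rewrite tnth_mktuple e'E mulrDr mulrN expr2.
have -> : translate e @^-1` E = linform e @^-1` `[- eucl e * eucl e, +oo[.
  rewrite /E; apply/seteqP; split => t /=;
    by rewrite !in_itv/= !andbT trE mulNr -[(- _ <= _)]subr_ge0 opprK.
have -> : translate e' @^-1` (~` E) = ~` (linform e @^-1` `[eucl e * eucl e, +oo[).
  by rewrite preimage_setC /E; congr (~` _);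
    apply/seteqP; split => t /=; rewrite !in_itv/= !andbT trE' subr_ge0.
have mI a : measurable (linform e @^-1` `[a, +oo[).
  exact: measurable_preimage_linform.
rewrite probability_setC//.
(* When e = 0 the form is not normal, but the test is blind: the bound is 1. *)
have := sqrtr_ge0 (\sum_i e i ^+ 2).
rewrite le_eqVlt => /orP[/eqP s0|s0].
  have -> : linform e @^-1` `[eucl e * eucl e, +oo[ = setT.
    apply/seteqP; split => t //= _.
    by rewrite in_itv/= andbT linform_eq0// -s0 mulr0.
  rewrite -s0 gauss_tail0 [X in (_ + (_ - X))%E]probability_setT subee// adde0.
  have -> : 2 - 2 * (1 / 2) = 1 :> R by field.
  exact: probability_le1.
rewrite [X in (X + _)%E]std_gaussian_linform_tail//.
rewrite [X in (_ + (_ - X))%E]std_gaussian_linform_tail//.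
by rewrite gauss_tailN -EFinB -EFinD lee_fin; lra.
Qed.

End gaussian_testing.

(** * Dominated extension of linear functionals *)

(** Finite-dimensional form of the M. Riesz extension theorem: the convex cone
    [P] of pairs (y, r) stands for the epigraph of a sublinear function.
    Stating domination through [P] spares the gauge itself, an infimum whose
    attainment would have to be discussed. *)
Section riesz_extension.
Context {R : realType} {p : nat}.
Context (P : 'rV[R]_p -> R -> Prop).
Context (PD : forall y y' r r', P y r -> P y' r' -> P (y + y') (r + r')).
Context (PZ : forall (a : R) y r, 0 < a -> P y r -> P (a *: y) (a * r)).
Context (P_total : forall y, exists r, P y r).

(** One more direction [y]: the values [t] allowed at [y] are those between the
    supremum of the lower constraints and the infimum of the upper ones, and
    adding a lower and an upper constraint shows that this interval is not
    empty. *)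
Lemma dominated_extension1 {n} (M : 'M[R]_(n, p)) (c : 'cV[R]_n) (y : 'rV[R]_p) :
  (forall x r, P (x *m M) r -> (x *m c) 0 0 <= r) ->
  exists t : R, forall x s r,
    P (x *m M + s *: y) r -> (x *m c) 0 0 + s * t <= r.
Proof.
move=> dom.
pose A := [set w | exists x r, P (x *m M - y) r /\ w = (x *m c) 0 0 - r].
have AB x r : P (x *m M + y) r -> ubound A (r - (x *m c) 0 0).
  move=> Pr _ [x' [r' [Pr' ->]]].
  have := PD _ _ _ _ Pr Pr'; rewrite addrACA subrr addr0 -mulmxDl => /dom.
  by rewrite mulmxDl mxE; lra.
have A0 : A !=set0.
  have [r Pr] := P_total ((0 : 'rV_n) *m M - y).
  by exists (((0 : 'rV_n) *m c) 0 0 - r), 0, r.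
have [r0 Pr0] := P_total ((0 : 'rV_n) *m M + y).
have supA : has_sup A.
  by split => //; exists (r0 - ((0 : 'rV_n) *m c) 0 0); exact: AB.
exists (sup A) => x s r; have [s0|s0|->] := ltgtP s 0.
- have s'0 : 0 < (- s)^-1 by rewrite invr_gt0 oppr_gt0.
  move=> /(PZ _ _ _ s'0); rewrite scalerDr scalerA invrN mulNr mulVf ?lt_eqF//.
  rewrite scaleN1r scalemxAl => Pr.
  have : ((- s^-1 *: x) *m c) 0 0 - (- s^-1 * r) <= sup A.
    by apply: ub_le_sup; [exact: supA.2|exists (- s^-1 *: x), (- s^-1 * r)].
  rewrite -scalemxAl mxE -mulrBr => /(ler_wnM2l (ltW s0)).
  rewrite mulrA mulrN divff ?lt_eqF// mulN1r; lra.
- have s'0 : 0 < s^-1 by rewrite invr_gt0.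
  move=> /(PZ _ _ _ s'0); rewrite scalerDr scalerA mulVf ?gt_eqF//.
  rewrite scale1r scalemxAl => /AB/(ge_sup A0).
  rewrite -scalemxAl mxE -mulrBr => /(ler_wpM2l (ltW s0)).
  by rewrite mulrA divff ?gt_eqF// mul1r; lra.
- by rewrite scale0r addr0 mul0r addr0; exact: dom.
Qed.

Lemma dominated_extension {n k} (M : 'M[R]_(n, p)) (c : 'cV[R]_n)
    (N : 'M[R]_(k, p)) :
  (forall x r, P (x *m M) r -> (x *m c) 0 0 <= r) ->
  exists d : 'cV[R]_k, forall x z r,
    P (x *m M + z *m N) r -> (x *m c) 0 0 + (z *m d) 0 0 <= r.
Proof.
move=> dom; elim: k N => [|k IH] N.
  exists 0 => x z r; rewrite (flatmx0 N) !mulmx0 addr0 [X in _ + X <= _]mxE addr0.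
  exact: dom.
rewrite -[k.+1]/(1 + k)%N in N *.
have [d dP] := IH (dsubmx N).
have [|t tP] :=
    @dominated_extension1 _ (col_mx M (dsubmx N)) (col_mx c d) (usubmx N).
  move=> x r; rewrite -(hsubmxK x) !mul_row_col => /dP.
  by rewrite [in X in _ -> X]mxE.
exists (col_mx t%:M d) => x z r.
rewrite -(hsubmxK z) -(vsubmxK N) !mul_row_col.
have -> : lsubmx z = (lsubmx z 0 0)%:M by rewrite [LHS]mx11_scalar.
set a := lsubmx z 0 0; set z' := rsubmx z.
rewrite mul_scalar_mx addrA (addrAC _ _ (z' *m _)) -(mul_row_col x) => /tP.
rewrite !mul_row_col mul_scalar_mx scale_scalar_mx.
have -> : (a * t)%:M = const_mx (a * t) :> 'M[R]_1.
  by apply/matrixP => i j; rewrite !mxE !ord1 eqxx mulr1n.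
rewrite [(_ + _ *m _) 0 0]mxE [(const_mx _ + _) 0 0]mxE [const_mx _ 0 0]mxE.
lra.
Qed.

(** Extending along the rows of the identity matrix defines the functional on
    the whole space; [x] and [- x M] together then have value at most 0, which
    forces the extension to agree with [c]. *)
Lemma riesz_extension {n} (M : 'M[R]_(n, p)) (c : 'cV[R]_n) :
  (forall x r, P (x *m M) r -> (x *m c) 0 0 <= r) ->
  exists g : 'cV[R]_p, c = M *m g /\ forall y r, P y r -> (y *m g) 0 0 <= r.
Proof.
move=> dom; have [g gP] := dominated_extension M c 1%:M dom.
exists g; split; last first.
  move=> y r Py; have := gP 0 y r.
  by rewrite !mul0mx mulmx1 add0r [X in X + _]mxE add0r; exact.
have le0 (x : 'rV_n) : (x *m (c - M *m g)) 0 0 <= 0.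
  have [r Pr] := P_total 0.
  have H (a : R) : 0 < a -> (x *m (c - M *m g)) 0 0 <= a * r.
    move=> a0; have := gP x (- (x *m M)) (a * r).
    rewrite mulmx1 subrr mulmxBr mulNmx mulmxA !mxE; apply.
    by rewrite -[0](scaler0 _ a); exact: PZ.
  rewrite leNgt; apply/negP => v0.
  have r0 : 0 < r by have := H 1 ltr01; rewrite mul1r; exact: lt_le_trans.
  set v := (_ *m _) 0 0 in v0 H *.
  have := H (v / r / 2) (divr_gt0 (divr_gt0 v0 r0) (ltr0Sn _ _)).
  rewrite (_ : v / r / 2 * r = v / 2); last by field; rewrite gt_eqF.
  lra.
apply/eqP; rewrite -subr_eq0; apply/eqP/matrixP => i j; rewrite ord1.
have E (x : 'rV_n) : (x *m (c - M *m g)) 0 0 = 0.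
  apply/eqP; rewrite eq_le le0/=.
  by have := le0 (- x); rewrite mulNmx mxE oppr_le0.
have := E (delta_mx 0 i); rewrite -rowE mxE => ->; by rewrite mxE.
Qed.

End riesz_extension.

(** * Norms, scalar products and blocks *)

Section vectors.
Context {R : realType}.

Lemma mx_norm_ge0_le {p q} (M : 'M[R]_(p, q)) (a : R) : 0 <= a ->
  `|M| <= a <-> forall i j, `|M i j| <= a.
Proof.
move=> a0; rewrite {1}/Num.norm /= mx_normrE; split.
  by move=> /bigmax_leP[_ +] i j => /(_ (i, j)); exact.
by move=> H; apply/bigmax_leP; split => // -[i j] _; exact: H.
Qed.

Lemma entry_le_norm {p q} (M : 'M[R]_(p, q)) i j : `|M i j| <= `|M|.
Proof. exact: (mx_norm_ge0_le M _ (normr_ge0 M)).1. Qed.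

Lemma dotvE {p} (u v : 'cV[R]_p) : dotv u v = \sum_i u i 0 * v i 0.
Proof. by rewrite /dotv mxE; apply: eq_bigr => i _; rewrite mxE. Qed.

Lemma dotvC {p} (u v : 'cV[R]_p) : dotv u v = dotv v u.
Proof. by rewrite !dotvE; apply: eq_bigr => i _; rewrite mulrC. Qed.

Lemma dotvD {p} (u u' v : 'cV[R]_p) : dotv (u + u') v = dotv u v + dotv u' v.
Proof. by rewrite /dotv linearD/= mulmxDl mxE. Qed.

Lemma dotvN {p} (u v : 'cV[R]_p) : dotv (- u) v = - dotv u v.
Proof. by rewrite /dotv linearN/= mulNmx mxE. Qed.

Lemma dotvZ {p} a (u v : 'cV[R]_p) : dotv (a *: u) v = a * dotv u v.
Proof. by rewrite /dotv linearZ/= -scalemxAl mxE. Qed.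

Lemma dotv_mulmx {p q} (D : 'M[R]_(p, q)) (u : 'cV[R]_q) (v : 'cV[R]_p) :
  dotv (D *m u) v = dotv u (D^T *m v).
Proof. by rewrite /dotv trmx_mul mulmxA. Qed.

Lemma norm2_ge0 {p} (v : 'cV[R]_p) : 0 <= norm2 v.
Proof. exact: sqrtr_ge0. Qed.

Lemma norm2_sqr {p} (v : 'cV[R]_p) : norm2 v ^+ 2 = \sum_i v i 0 ^+ 2.
Proof. by rewrite sqr_sqrtr// sumr_ge0// => i _; exact: sqr_ge0. Qed.

Lemma dotvv {p} (v : 'cV[R]_p) : dotv v v = norm2 v ^+ 2.
Proof. by rewrite dotvE norm2_sqr; apply: eq_bigr => i _; rewrite expr2. Qed.

Lemma norm2Z {p} a (v : 'cV[R]_p) : 0 <= a -> norm2 (a *: v) = a * norm2 v.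
Proof.
move=> a0; apply/eqP; rewrite -(eqrXn2 (ltn0Sn 1)) ?mulr_ge0 ?norm2_ge0//.
rewrite exprMn !norm2_sqr mulr_sumr; apply/eqP; apply: eq_bigr => i _.
by rewrite mxE exprMn.
Qed.

Lemma norm2_0 {p} : norm2 (0 : 'cV[R]_p) = 0.
Proof. by rewrite -(scale0r 0) norm2Z// mul0r. Qed.

(** Convexity of the Euclidean ball comes from convexity of the square, one
    coordinate at a time. *)
Lemma norm2_conv {p} (b l l' : R) (e e' : 'cV[R]_p) :
  0 <= l -> 0 <= l' -> l + l' = 1 -> norm2 e <= b -> norm2 e' <= b ->
  norm2 (l *: e + l' *: e') <= b.
Proof.
move=> l0 l'0 ll' eb e'b.
have b0 : 0 <= b by exact: le_trans (norm2_ge0 e) eb.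
rewrite -(ler_pXn2r (ltn0Sn 1)) ?nnegrE ?norm2_ge0// norm2_sqr.
have e2 : norm2 e ^+ 2 <= b ^+ 2.
  by rewrite ler_pXn2r ?nnegrE ?norm2_ge0.
have e'2 : norm2 e' ^+ 2 <= b ^+ 2.
  by rewrite ler_pXn2r ?nnegrE ?norm2_ge0.
apply: (@le_trans _ _ (l * norm2 e ^+ 2 + l' * norm2 e' ^+ 2)).
  rewrite !norm2_sqr !mulr_sumr -big_split/=; apply: ler_sum => i _.
  rewrite !mxE -subr_ge0.
  have -> : l * e i 0 ^+ 2 + l' * e' i 0 ^+ 2 - (l * e i 0 + l' * e' i 0) ^+ 2 =
    l * l' * (e i 0 - e' i 0) ^+ 2.
    have -> : l = 1 - l' by rewrite -ll' addrK.
    by ring.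
  by rewrite mulr_ge0 ?sqr_ge0// mulr_ge0.
rewrite -[leRHS]mul1r -ll' mulrDl lerD// ler_wpM2l//.
Qed.

Lemma convex_setP {p} (U : set 'cV[R]_p) (l l' : R) (u u' : 'cV[R]_p) :
  convex_set U -> 0 <= l -> 0 <= l' -> l + l' = 1 -> U u -> U u' ->
  U (l *: u + l' *: u').
Proof.
move=> cU l0 l'0 ll' Uu Uu'.
have l1 : l <= 1 by rewrite -ll' lerDl.
have := cU u u' (Itv01 l0 l1).
rewrite !inE => /(_ Uu Uu').
suff -> : l' = 1 - l by [].
by rewrite -ll' addrC addKr.
Qed.

End vectors.

Section blocks.
Context {R : realType} {K : nat} {n_ : 'I_K -> nat}.
Implicit Types w : 'cV[R]_(\sum_k n_ k).

Lemma L1_0 : L1 (0 : 'cV[R]_(\sum_k n_ k)) = 0.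
Proof. by rewrite /L1 big1// => k _; rewrite submxcol0 normr0. Qed.

Lemma L1N w : L1 (- w) = L1 w.
Proof. by apply: eq_bigr => k _; rewrite submxcolN normrN. Qed.

Lemma L1Z a w : 0 <= a -> L1 (a *: w) = a * L1 w.
Proof.
move=> a0; rewrite /L1 mulr_sumr; apply: eq_bigr => k _.
have -> : submxcol (a *: w) k = a *: submxcol w k.
  by apply/matrixP => i j; rewrite !mxE.
by rewrite normrZ ger0_norm.
Qed.

Lemma L1D w w' : L1 (w + w') <= L1 w + L1 w'.
Proof.
rewrite /L1 -big_split/=; apply: ler_sum => k _.
by rewrite submxcolD; exact: ler_normD.
Qed.

Lemma L1_sub_trunc S w : L1 (w - trunc_blocks S w) <= L1 w.
Proof.
apply: ler_sum => k _; rewrite submxcolB mxcolK.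
by case: ifP => _; rewrite ?subrr ?normr0 ?subr0.
Qed.

(** A block [V^(k l)] applied to [u] is [V] applied to the vector whose only
    nonzero block is [u] in position [l]; its [L1] is the norm of [u]. *)
Lemma opnorm_inf_submxblock (V : 'M[R]_(\sum_k n_ k)) (a : R) k l :
  0 <= a ->
  (forall i w, dotv w (row i V)^T <= a * L1 w) ->
  opnorm_inf (submxblock V k l) <= a.
Proof.
move=> a0 Va; apply: ge_sup; first by
  exists `|submxblock V k l *m (0 : 'cV_(n_ l))|, 0 => //=; rewrite normr0.
move=> _ [u /= u1 <-]; apply/mx_norm_ge0_le => // i j; rewrite {j}ord1.
(* The blocks of w have dependent sizes: conform_mx is the identity at l. *)
pose w (u : 'cV[R]_(n_ l)) :=
  \mxcol_k' (if k' == l then conform_mx 0 u else 0) : 'cV[R]_(\sum_k n_ k).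
have wE (u' : 'cV[R]_(n_ l)) : (submxblock V k l *m u') i 0 =
    dotv (w u') (row (tagnat.Rank k i) V)^T.
  have -> : dotv (w u') (row (tagnat.Rank k i) V)^T =
      submxcol (V *m w u') k i 0.
    by rewrite dotvC /dotv trmxK -row_mul !mxE.
  rewrite -[in RHS](submxblockK V) mul_mxblock_mxrow mxcolK (bigD1 l)//=.
  rewrite eqxx conform_mx_id big1 ?addr0// => k' kl.
  by rewrite (negbTE kl) mulmx0.
have L1w (u' : 'cV[R]_(n_ l)) : L1 (w u') = `|u'|.
  rewrite /L1 (bigD1 l)//= mxcolK eqxx conform_mx_id big1 ?addr0// => k' kl.
  by rewrite mxcolK (negbTE kl) normr0.
rewrite ler_norml; apply/andP; split.
- rewrite lerNl; have := Va (tagnat.Rank k i) (w (- u)).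
  rewrite -wE L1w normrN mulmxN mxE => /le_trans; apply.
  by rewrite ler_piMr.
- rewrite wE; apply: le_trans (Va _ _) _.
  by rewrite L1w ler_piMr.
Qed.

End blocks.

(** * Observations with Gaussian noise *)

Section noise.
Context {R : realType} {m : nat}.
Local Notation T := (measurableTypeR R).
Local Notation gam := (std_gaussian R m).
Context (D : 'M[R]_m).

Lemma colvec_translate (e : 'cV[R]_m) (t : m.-tuple T) :
  colvec (translate (fun i => e i 0) t) = colvec t + e.
Proof. by apply/matrixP => i j; rewrite !mxE tnth_mktuple ord1. Qed.

Lemma dotv_colvec (t : m.-tuple T) (h : 'cV[R]_m) :
  dotv (D *m colvec t) h = linform (fun i => (D^T *m h) i 0) t.
Proof.
rewrite dotv_mulmx dotvC dotvE; apply: eq_bigr => i _.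
by rewrite [X in _ * X]mxE.
Qed.

Lemma translateK (e e' : 'I_m -> R) : (forall i, e' i = - e i) ->
  cancel (translate e') (translate e).
Proof.
move=> e'E t; apply: eq_from_tnth => i.
by rewrite !tnth_mktuple e'E subrK.
Qed.

(** Disjoint events that are both likely, one under the shift [D e] and the
    other under the opposite shift, make a good test between the two. *)
Lemma noise_separation (e : 'cV[R]_m) (E E' : set 'cV[R]_m) (eps : R) :
  noise_prob_ge D [set xi | E (D *m e + xi)] (1 - eps) ->
  noise_prob_ge D [set xi | E' (- (D *m e) + xi)] (1 - eps) ->
  E `&` E' = set0 ->
  gauss_tail (norm2 e) <= eps.
Proof.
move=> [mE pE] [mE' pE'] EE'.
pose a i := e i 0; pose a' i := - a i.
pose G := [set t : m.-tuple T | E (D *m colvec t)].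
pose G' := [set t : m.-tuple T | E' (D *m colvec t)].
have aG : [set t | E (D *m e + D *m colvec t)] = translate a @^-1` G.
  by apply/seteqP; split => t; rewrite /G /= colvec_translate mulmxDr addrC.
have a'G : [set t | E' (- (D *m e) + D *m colvec t)] = translate a' @^-1` G'.
  have a'E : a' = fun i => (- e) i 0 by apply/funext => i; rewrite mxE.
  by apply/seteqP; split => t;
    rewrite /G' /= a'E colvec_translate mulmxDr mulmxN addrC.
(* Only the shifted events are known to be measurable: shift them back. *)
have mG : measurable G.
  have -> : G = translate a' @^-1` (translate a @^-1` G).
    by apply/seteqP; split => t /=; rewrite translateK.
  by apply: measurable_preimage_translate; rewrite -aG.
have mG' : measurable G'.
  have -> : G' = translate a @^-1` (translate a' @^-1` G').
    by apply/seteqP; split => t /=; rewrite translateK// => i; rewrite opprK.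
  by apply: measurable_preimage_translate; rewrite -a'G.
have GG' : G `&` G' = set0.
  rewrite -subset0 => t [Gt G't].
  by have : (E `&` E') (D *m colvec t) by []; rewrite EE'.
have := two_point_test a a' G G' (fun=> erefl) mG mG' GG'.
rewrite -aG -a'G => /(le_trans (leeD pE pE')).
rewrite -EFinD lee_fin -/(norm2 e); lra.
Qed.

Lemma union_bound (n : nat) (A : 'I_n -> set (m.-tuple T)) (p : 'I_n -> R) :
  (forall i, measurable (A i)) -> (forall i, gam (A i) <= (p i)%:E)%E ->
  ((1 - \sum_i p i)%:E <= gam (\bigcap_i ~` A i))%E.
Proof.
move=> mA pA.
(* The events are extended by set0 to a sequence indexed by nat. *)
pose B k := oapp A set0 (insub k : option 'I_n).
have BE : \big[setU/set0]_(i < n) B i = \bigcup_i A i.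
  apply/seteqP; split => [t|t [i _ At]].
    rewrite -bigcup_mkord => -[k /= kn]; rewrite /B insubT/= => At.
    by exists (Ordinal kn).
  by rewrite (bigD1 i)//=; left; rewrite /B valK.
rewrite -setC_bigcup -BE.
have mB k : (k < n)%N -> measurable (B k) by move=> kn; rewrite /B insubT/=.
have mU : measurable (\big[setU/set0]_(i < n) B i).
  by apply: bigsetU_measurable => i _; exact: mB.
rewrite probability_setC// EFinB leeB//.
apply: le_trans (Boole_inequality _ mB) _.
rewrite -sumEFin; apply: lee_sum => i _.
by rewrite /B valK /=.
Qed.

End noise.

(** * From the recovery routine to a certificate *)

Section recovery.
Context {R : realType} {m n K : nat} {n_ : 'I_K -> nat}.
Local Notation N := (\sum_k n_ k)%N.

(** If [B x] were larger, the events that [x] and that [- x] are recovered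
    within the tolerance would be disjoint, since [B x] and [- B x] are at
    distance [2 * `|B x|], and [noise_separation] would give
    [gauss_tail (norm2 e) <= eps] although [norm2 e < ErfInv eps]. *)
Lemma recovery_bound (A : 'M[R]_(m, n)) (B : 'M[R]_(N, n)) (U : set 'cV[R]_m)
    (D : 'M[R]_m) (eps alpha : R) (S : nat) (xhat : 'cV[R]_m -> 'cV[R]_n)
    (x : 'cV[R]_n) (u e : 'cV[R]_m) :
  (forall u, U u -> U (- u)) -> 0 < eps -> eps < 1 / 2 ->
  (forall (x : 'cV[R]_n) (u : 'cV[R]_m), U u ->
    noise_prob_ge D
      [set xi | `|B *m (x - xhat (A *m x + u + xi))|
                  <= alpha + S%:R^-1 * L1 (B *m x - trunc_blocks S (B *m x))]
      (1 - eps)) ->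
  U u -> norm2 e <= ErfInv eps / 2 -> A *m x = u + D *m e ->
  `|B *m x| <= alpha + S%:R^-1 * L1 (B *m x).
Proof.
move=> U_sym eps0 eps_lt xhat_recovers Uu e_le Ax.
rewrite leNgt; apply/negP => lt_Bx.
pose tau z := alpha + S%:R^-1 * L1 (B *m z - trunc_blocks S (B *m z)).
pose E z := [set y | `|B *m (z - xhat y)| <= tau z].
have tau_le z : tau z <= alpha + S%:R^-1 * L1 (B *m z).
  by rewrite lerD2l ler_wpM2l ?invr_ge0// L1_sub_trunc.
have : gauss_tail (norm2 e) <= eps.
  apply: (@noise_separation _ _ D e (E x) (E (- x))).
  - have := xhat_recovers x (- u) (U_sym _ Uu).
    by rewrite Ax addrAC subrr add0r.
  - have := xhat_recovers (- x) u Uu.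
    by rewrite mulmxN Ax opprD addrAC addNr add0r.
  rewrite -subset0 => y [/= Ex ENx].
  have : `|2 *: (B *m x)| <= tau x + tau (- x).
    apply: le_trans (lerD Ex ENx).
    rewrite (_ : 2 *: _ = B *m (x - xhat y) - B *m (- x - xhat y)).
      exact: ler_normB.
    by rewrite -mulmxBr opprB opprK addrA subrK mulmxDr scaler_nat mulr2n.
  rewrite normrZ ger0_norm//; have := tau_le x; have := tau_le (- x).
  by rewrite mulmxN L1N; move: lt_Bx; lra.
have eps1 : eps < 1 by lra.
have beta0 := ErfInv_gt0 eps eps0 eps_lt.
rewrite -[X in _ <= X](gauss_tail_ErfInv eps)// gauss_tail_le.
move=> /le_trans/(_ e_le).
lra.
Qed.

(** Duality: [P] below is the epigraph of [a * L1] plus [alpha] times the gauge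
    of [U + D (ball of radius b)] on the space of pairs (B x, A x).  A
    functional below [P] splits into [v] on the first component and [h] on the
    second. *)
Lemma row_certificate (A : 'M[R]_(m, n)) (B : 'M[R]_(N, n)) (U : set 'cV[R]_m)
    (D : 'M[R]_m) (a alpha b : R) (i : 'I_N) :
  convex_set U -> (forall u, U u -> U (- u)) -> 0 <= a -> 0 <= alpha -> 0 < b ->
  nbhs (0 : 'cV[R]_m)
    [set w | exists u e : 'cV[R]_m, [/\ U u, norm2 e <= b & w = u + D *m e]] ->
  (forall x u e, U u -> norm2 e <= b -> A *m x = u + D *m e ->
    `|B *m x| <= alpha + a * L1 (B *m x)) ->
  exists (v : 'cV[R]_N) (h : 'cV[R]_m),
    [/\ row i B = v^T *m B + h^T *m A,
        forall w, dotv w v <= a * L1 w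
      & forall u e, U u -> norm2 e <= b -> dotv (u + D *m e) h <= alpha].
Proof.
move=> cU U_sym a0 alpha0 b0 nbW bound.
have U0 : U 0.
  have [u [_ [Uu _ _]]] := nbhs_singleton nbW.
  have h0 : 0 <= (2^-1 : R) by rewrite invr_ge0.
  have h1 : 2^-1 + 2^-1 = 1 :> R by field.
  have := convex_setP _ _ _ _ _ cU h0 h0 h1 Uu (U_sym _ Uu).
  by rewrite scalerN subrr.
pose P (y : 'rV[R]_(N + m)) (r : R) := exists (s : R) (u e : 'cV[R]_m),
  [/\ 0 < s, U u, norm2 e <= b, (rsubmx y)^T = s *: (u + D *m e)
    & alpha * s + a * L1 (lsubmx y)^T <= r].
have PD y y' r r' : P y r -> P y' r' -> P (y + y') (r + r').
  move=> [s [u [e [s0 Uu eb ye yr]]]] [s' [u' [e' [s'0 Uu' e'b y'e y'r]]]].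
  have ss0 : 0 < s + s' by exact: addr_gt0.
  pose l := s / (s + s'); pose l' := s' / (s + s').
  have l0 : 0 <= l by rewrite divr_ge0 ?ltW.
  have l'0 : 0 <= l' by rewrite divr_ge0 ?ltW.
  have ll' : l + l' = 1 by rewrite -mulrDl divff ?gt_eqF.
  exists (s + s'), (l *: u + l' *: u'), (l *: e + l' *: e'); split => //.
  - exact: convex_setP.
  - exact: norm2_conv.
  - rewrite linearD linearD/= ye y'e mulmxDr -!scalemxAr addrACA -!scalerDr.
    rewrite [RHS]scalerDr !scalerA.
    by congr (_ *: _ + _ *: _); rewrite mulrC divfK ?gt_eqF.
  - rewrite linearD/= [(_ + _)^T]linearD/=.
    have := ler_wpM2l a0 (L1D (lsubmx y)^T (lsubmx y')^T).
    by move: yr y'r; lra.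
have PZ (c : R) y r : 0 < c -> P y r -> P (c *: y) (c * r).
  move=> c0 [s [u [e [s0 Uu eb ye yr]]]]; exists (c * s), u, e; split => //.
  - exact: mulr_gt0.
  - by rewrite !linearZ/= ye scalerA.
  - rewrite !linearZ/= (L1Z _ _ (ltW c0)) (mulrCA alpha) (mulrCA a) -mulrDr.
    by rewrite ler_pM2l.
have P_total y : exists r, P y r.
  have /nbhs_ballP[d /= d0 dW] := nbW.
  pose z := (rsubmx y)^T; pose s := (`|z| + 1) * (2 / d).
  have s0 : 0 < s by rewrite mulr_gt0 ?divr_gt0// ltr_wpDl.
  have : ball (0 : 'cV[R]_m) d (s^-1 *: z).
    rewrite -ball_normE /= sub0r normrN normrZ gtr0_norm ?invr_gt0//.
    have ds : d * s = 2 * `|z| + 2 by rewrite /s; field; rewrite gt_eqF.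
    by rewrite mulrC ltr_pdivrMr// ds; have := normr_ge0 z; lra.
  move=> /dW[u [e [Uu eb zE]]].
  exists (alpha * s + a * L1 (lsubmx y)^T), s, u, e; split => //.
  by rewrite -zE scalerA divff ?gt_eqF// scale1r.
pose M : 'M[R]_(n, N + m) := row_mx B^T A^T.
have dom x r : P (x *m M) r -> (x *m (row i B)^T) 0 0 <= r.
  move=> [s [u [e [s0 Uu eb]]]].
  rewrite /M mul_mx_row row_mxKr row_mxKl !trmx_mul !trmxK => xe xr.
  have xe' : A *m (s^-1 *: x^T) = u + D *m e.
    by rewrite -scalemxAr xe scalerA mulVf ?gt_eqF// scale1r.
  have := bound _ _ _ Uu eb xe'.
  have s'0 : 0 < s^-1 by rewrite invr_gt0.
  rewrite -scalemxAr normrZ gtr0_norm// (L1Z _ _ (ltW s'0)).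
  move=> /(ler_wpM2l (ltW s0)); rewrite mulrA divff ?gt_eqF// mul1r => le_Bx.
  have -> : (x *m (row i B)^T) 0 0 = (B *m x^T) i 0.
    by rewrite -[x in LHS]trmxK -trmx_mul -row_mul !mxE.
  apply: le_trans (ler_norm _) _; apply: le_trans (entry_le_norm _ _ _) _.
  apply: le_trans le_Bx _; apply: le_trans xr.
  rewrite le_eqVlt; apply/orP; left; apply/eqP.
  by field; rewrite gt_eqF.
have [g [cg gP]] := riesz_extension P PD PZ P_total M _ dom.
exists (usubmx g), (dsubmx g); split.
- apply: trmx_inj; rewrite cg -[in LHS](vsubmxK g) mul_row_col.
  by rewrite linearD/= !trmx_mul !trmxK.
(* The cone only contains scalings s > 0, so at (w, 0) the gauge is made smaller
   than any d > 0 instead of 0. *)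
- move=> w; apply/ler_addgt0Pr => d d0.
  have := gP (row_mx w^T 0) (a * L1 w + d).
  rewrite -[in X in X -> _](vsubmxK g) mul_row_col mul0mx addr0; apply.
  exists (d / (alpha + 1)), 0, 0; split => //.
  - by rewrite divr_gt0// ltr_wpDl.
  - by rewrite norm2_0; exact: ltW.
  - by rewrite row_mxKr trmx0 mulmx0 addr0 scaler0.
  - rewrite row_mxKl trmxK addrC lerD2l mulrCA ler_piMr//; first exact: ltW.
    by rewrite ler_pdivrMr ?mul1r ?lerDl// ltr_wpDl.
- move=> u e Uu eb.
  have := gP (row_mx 0 (u + D *m e)^T) alpha.
  rewrite -[in X in X -> _](vsubmxK g) mul_row_col mul0mx add0r; apply.
  exists 1, u, e; split => //; first by rewrite row_mxKr trmxK scale1r.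
  by rewrite row_mxKl trmx0 L1_0 mulr0 addr0 mulr1.
Qed.

End recovery.

(** * Support functions, coverage, and the theorem *)

(** The best [e] in the ball is along [D^T h]; by symmetry the support function
    of [U] is nonnegative. *)
Lemma support_bound {R : realType} {m : nat} (U : set 'cV[R]_m) (D : 'M[R]_m)
    (alpha b : R) (h : 'cV[R]_m) :
  U !=set0 -> (forall u, U u -> U (- u)) -> 0 <= b ->
  (forall u e, U u -> norm2 e <= b -> dotv (u + D *m e) h <= alpha) ->
  0 <= sup [set dotv u h | u in U] /\
  sup [set dotv u h | u in U] + b * norm2 (D^T *m h) <= alpha.
Proof.
move=> [u0 Uu0] U_sym b0 hP; set s := sup _; set g := D^T *m h.
have ub u : U u -> dotv u h <= alpha - b * norm2 g.
  move=> Uu; have [g0|g0] := eqVneq (norm2 g) 0.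
    have := hP u 0 Uu; rewrite g0 mulr0 subr0 mulmx0 addr0; apply.
    by rewrite norm2_0.
  pose e := (b / norm2 g) *: g.
  have := hP u e Uu; rewrite dotvD dotv_mulmx dotvZ -/g dotvv norm2Z; last first.
    by rewrite divr_ge0 ?norm2_ge0.
  rewrite divfK// lexx expr2 mulrA divfK// => /(_ isT); lra.
have s_ub : has_ubound [set dotv u h | u in U].
  by exists (alpha - b * norm2 g) => _ [u Uu <-]; exact: ub.
split; last first.
  rewrite -lerBrDr; apply: ge_sup; first by exists (dotv u0 h), u0.
  by move=> _ [u Uu <-]; exact: ub.
have H u : U u -> dotv u h <= s by move=> Uu; apply: ub_le_sup => //; exists u.
have := H _ Uu0; have := H _ (U_sym _ Uu0); rewrite dotvN; lra.
Qed.

(** Each column fails with probability at most [eps / N], twice the tail at the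
    quantile of [eps / (2 N)]. *)
Lemma noise_coverage {R : realType} {m N : nat} (D : 'M[R]_m) (h : 'I_N -> 'cV[R]_m)
    (q : 'I_N -> R) (rho eps : R) : (0 < N)%N -> 0 < eps -> eps < 1 / 2 ->
  (forall i, q i + ErfInv (eps / (2 * N%:R)) * norm2 (D^T *m h i) <= rho) ->
  noise_prob_ge D [set xi | forall i, q i + `|dotv xi (h i)| <= rho] (1 - eps).
Proof.
move=> N_gt0 eps0 eps_lt q_rho; set c := ErfInv _ in q_rho.
have N0 : 0 < N%:R :> R by rewrite ltr0n.
have N1 : 1 <= N%:R :> R by rewrite ler1n.
have d0 : 0 < eps / (2 * N%:R) by rewrite divr_gt0// mulr_gt0.
have d_lt : eps / (2 * N%:R) < 1 / 2.
  rewrite ltr_pdivrMr ?mulr_gt0//; nra.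
have d1 : eps / (2 * N%:R) < 1 by lra.
have c0 : 0 < c by exact: ErfInv_gt0.
pose g i : 'I_m -> R := fun j => (D^T *m h i) j 0.
pose Bad i := [set t | c * norm2 (D^T *m h i) < `|linform (g i) t|].
pose E := [set t : m.-tuple (measurableTypeR R) |
  forall i, q i + `|dotv (D *m colvec t) (h i)| <= rho].
have mE : measurable E.
  have -> : E = \bigcap_i ~` [set t | rho - q i < `|linform (g i) t|].
    apply/seteqP; split => t tE i.
      move=> _ /= bad; have := tE i; rewrite dotv_colvec -/(g i); lra.
    rewrite dotv_colvec -/(g i) leNgt; apply/negP => bad.
    by apply: (tE i I) => /=; lra.
  apply: fin_bigcap_measurable => [|i _]; first exact: finite_finset.
  by apply: measurableC; exact: measurable_linform_norm_gt.
split => //.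
apply: (@le_trans _ _ (std_gaussian R m (\bigcap_i ~` Bad i))).
  have := union_bound N Bad (fun=> 2 * gauss_tail c)
    (fun i => measurable_linform_norm_gt (g i) _).
  have -> : 1 - \sum_(i < N) 2 * gauss_tail c = 1 - eps.
    rewrite sumr_const card_ord gauss_tail_ErfInv// -mulr_natr.
    by congr (1 - _); field; rewrite gt_eqF.
  by apply=> i; apply: std_gaussian_linform_norm; exact: ltW.
apply: le_measure; rewrite ?inE//.
  apply: fin_bigcap_measurable => [|i _]; first exact: finite_finset.
  by apply: measurableC; exact: measurable_linform_norm_gt.
move=> t tB i /=; rewrite dotv_colvec -/(g i) leNgt; apply/negP => bad.
apply: (tB i I); rewrite /Bad /= -(ltrD2l (q i)).
exact: le_lt_trans (q_rho i) bad.
Qed.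

Theorem proposition4p2 (R : realType) (m n K : nat) (n_ : 'I_K -> nat)
    (A : 'M[R]_(m, n)) (B : 'M[R]_(\sum_k n_ k, n))
    (U : set 'cV[R]_m) (D : 'M[R]_m) (eps alpha : R) (S : nat)
    (xhat : 'cV[R]_m -> 'cV[R]_n)
    (K_gt0 : (0 < K)%N) (n_gt0 : forall k, (0 < n_ k)%N)
    (U_compact : compact U) (U_convex : convex_set U)
    (U_sym : forall u, U u -> U (- u))
    (eps_gt0 : 0 < eps) (eps_lt : eps < 1 / 2)
    (UD_nbhs : forall r : R, 0 < r ->
      nbhs (0 : 'cV[R]_m)
        [set w | exists u e : 'cV[R]_m,
                   [/\ U u, norm2 e <= r & w = u + D *m e]])
    (S_gt0 : (0 < S)%N) (alpha_gt0 : 0 < alpha)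
    (xhat_recovers : forall (x : 'cV[R]_n) (u : 'cV[R]_m), U u ->
      noise_prob_ge D
        [set xi | `|B *m (x - xhat (A *m x + u + xi))|
                    <= alpha + S%:R^-1 * L1 (B *m x - trunc_blocks S (B *m x))]
        (1 - eps)) :
  exists (H : 'M[R]_(m, \sum_k n_ k)) (V : 'M[R]_(\sum_k n_ k, \sum_k n_ k)),
    let N := (\sum_k n_ k)%N in
    let h i := col i H in
    let supU i := sup [set dotv u (h i) | u in U] in
    let rho := sup (range (fun i : 'I_(\sum_k n_ k) =>
                 supU i + ErfInv (eps / (2 * N%:R)) * norm2 (D^T *m h i))) in
    [/\ B = V *m B + H^T *m A,
        forall k l, opnorm_inf (submxblock V k l) <= 2 * S%:R^-1,
        D = 0 -> rho <= 2 * alpha,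
        D <> 0 ->
          rho <= 2 * alpha * (ErfInv (eps / (2 * N%:R)) / ErfInv eps)
      & noise_prob_ge D
          [set xi | forall i, supU i + `|dotv xi (h i)| <= rho]
          (1 - eps)].
Proof.
have S'_gt0 : 0 < S%:R :> R by rewrite ltr0n.
pose beta := ErfInv eps.
have beta0 : 0 < beta by exact: ErfInv_gt0.
have b0 : 0 < beta / 2 by rewrite divr_gt0.
have Sinv0 : 0 <= S%:R^-1 :> R by rewrite invr_ge0.
have bound x u e : U u -> norm2 e <= beta / 2 -> A *m x = u + D *m e ->
    `|B *m x| <= alpha + S%:R^-1 * L1 (B *m x).
  exact: recovery_bound U_sym eps_gt0 eps_lt xhat_recovers.
have cert i := row_certificate A B U D _ alpha _ i U_convex U_sym Sinv0
  (ltW alpha_gt0) b0 (UD_nbhs _ b0) bound.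
have [v vP] := choice cert.
have [h hP] := choice vP.
pose H : 'M[R]_(m, \sum_k n_ k) := \matrix_(j, i) h i j 0.
pose V : 'M[R]_(\sum_k n_ k) := \matrix_(i, j) v i j 0.
exists H, V => N h' supU rho.
have hE i : h' i = h i by apply/matrixP => j k; rewrite !mxE ord1.
have rowV i : row i V = (v i)^T by apply/matrixP => j k; rewrite !mxE ord1.
have rowH i : row i H^T = (h i)^T by apply/matrixP => j k; rewrite !mxE ord1.
have N_gt0 : (0 < N)%N.
  by rewrite /N (bigD1 (Ordinal K_gt0))//= ltn_addr.
have N0 : 1 <= N%:R :> R by rewrite ler1n.
pose beta' := ErfInv (eps / (2 * N%:R)).
have beta_le : beta <= beta'.
  apply: ErfInv_le; last by lra.
  - by rewrite divr_gt0// mulr_gt0// (lt_le_trans ltr01).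
  - rewrite ler_pdivrMr; last by rewrite mulr_gt0// (lt_le_trans ltr01).
    by rewrite ler_peMr; nra.
have [u0 [_ [Uu0 _ _]]] := nbhs_singleton (UD_nbhs _ b0).
have sup_bound i : 0 <= supU i /\ supU i + beta / 2 * norm2 (D^T *m h' i) <= alpha.
  apply: support_bound => //; [by exists u0|exact: ltW|].
  by move=> u e Uu eb; rewrite hE; have [_ _] := hP i; exact.
have term_le i : supU i + beta' * norm2 (D^T *m h' i) <=
    2 * alpha * (beta' / beta).
  have [s0 sb] := sup_bound i; have n0 := norm2_ge0 (D^T *m h' i).
  have r1 : 1 <= beta' / beta by rewrite ler_pdivlMr// mul1r.
  rewrite -[X in X * norm2 _](divfK (lt0r_neq0 beta0)).
  set r := beta' / beta in r1 *.
  set t := norm2 _ in sb n0 *; set s := supU i in s0 sb *.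
  (* 2 * (s + beta / 2 * t) <= 2 * alpha, and s >= 0 absorbs one s. *)
  have st : s + beta * t <= 2 * alpha by lra.
  have r0 : 0 <= r by lra.
  have := ler_wpM2l r0 st; have := ler_wpM2r s0 r1; lra.
have le_rho i : supU i + beta' * norm2 (D^T *m h' i) <= rho.
  apply: ub_le_sup; last by exists i.
  by exists (2 * alpha * (beta' / beta)) => _ [j _ <-]; exact: term_le.
pose i0 : 'I_N := Ordinal N_gt0.
have ne : range (fun i => supU i + beta' * norm2 (D^T *m h' i)) !=set0.
  by exists (supU i0 + beta' * norm2 (D^T *m h' i0)), i0.
split.
- apply/row_matrixP => i; rewrite linearD/= !row_mul rowV rowH.
  by have [] := hP i.
- move=> k l; apply: (@le_trans _ _ S%:R^-1); last by lra.
  apply: opnorm_inf_submxblock => // i w; rewrite rowV trmxK.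
  by have [_ + _] := hP i; exact.
- move=> D0; apply: ge_sup => //.
  move=> _ [i _ <-]; have [_] := sup_bound i.
  by rewrite D0 trmx0 !mul0mx norm2_0 !mulr0 !addr0; lra.
- move=> _; apply: ge_sup => //.
  by move=> _ [i _ <-]; exact: term_le.
- exact: noise_coverage.
Qed.
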